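(* Let $(Q,* )$ be a $2$-divisible semimedial left quasigroup, with squaring map $\mathfrak{s}$, and let $x\cdot_{\mathfrak{s}}y=\mathfrak{s}^{-1}(x*y)$. Then $(Q,* )$ is nilpotent of length $n$ if and only if $(Q,\cdot_{\mathfrak{s}})$ is nilpotent of length $n$.
   Context: A left quasigroup is a (nonempty) set $Q$ with a binary operation $*$ such that every $L_x:y\mapsto x*y$ is a bijection (with $x\backslash y=L_x^{-1}(y)$, regarded as a second basic operation). It is semimedial if $(x*x)*(y*z)=(x*y)*(x*z)$ for all $x,y,z$, and $2$-divisible if $\mathfrak{s}:a\mapsto a*a$ is a bijection. For $2$-divisible semimedial $(Q,* )$, $(Q,\cdot_{\mathfrak{s}})$ is a left quasigroup (in fact a quandle, i.e. idempotent and satisfying $x\cdot(y\cdot z)=(x\cdot y)\cdot(x\cdot z)$). Nilpotence is in the sense of commutator theory (term operations and congruences with respect to the multiplication and left division): for congruences $\alpha,\beta,\delta$ of an algebra $A$, $C(\alpha,\beta;\delta)$ means that for every $(k+1)$-ary term operation $t$, every $a\,\alpha\,b$ and all $u_1\,\beta\,v_1,\ldots,u_k\,\beta\,v_k$, $t(a,u_1,\ldots,u_k)\,\delta\,t(a,v_1,\ldots,v_k)$ implies $t(b,u_1,\ldots,u_k)\,\delta\,t(b,v_1,\ldots,v_k)$. A congruence $\alpha$ is central if $C(\alpha,1_A;0_A)$, where $0_A$ is equality and $1_A=A\times A$. $A$ is nilpotent if there is a chain of congruences $0_A=\alpha_0\leq\ldots\leq\alpha_m=1_A$ with $\alpha_{i+1}/\alpha_i$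 central in $A/\alpha_i$ for all $i$; the smallest such $m$ is the length of nilpotence. *)

(* Defs.v *)
From mathcomp Require Import all_boot generic_quotient.
From mathcomp Require Import boolp.

Set Implicit Arguments.
Unset Strict Implicit.
Unset Printing Implicit Defensive.

Local Open Scope quotient_scope.

(* [mulK] and [ldivK] say that [ldiv x] is the two-sided inverse of the left
   translation [mul x], so [ldiv] is determined by [mul]. *)
Record leftQuasigroup := LeftQuasigroup {
  carrier :> Type;
  mul : carrier -> carrier -> carrier;
  ldiv : carrier -> carrier -> carrier;
  nonempty : inhabited carrier;
  mulK : forall x, cancel (mul x) (ldiv x);
  ldivK : forall x, cancel (ldiv x) (mul x)
}.

Definition sq (Q : leftQuasigroup) (x : Q) : Q := mul x x.

Definition semimedial (Q : leftQuasigroup) : Prop :=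
  forall x y z : Q, mul (mul x x) (mul y z) = mul (mul x y) (mul x z).

Definition two_divisible (Q : leftQuasigroup) : Prop := bijective (@sq Q).

Section SquareIsotope.

Variables (Q : leftQuasigroup) (div2 : two_divisible Q).

Lemma sq_inv_exists :
  exists g : Q -> Q, cancel (@sq Q) g /\ cancel g (@sq Q).
Proof. by case: div2 => g sK gK; exists g. Qed.

Definition sq_inv : Q -> Q := sval (cid sq_inv_exists).

Lemma sqK : cancel (@sq Q) sq_inv.
Proof. by rewrite /sq_inv; case: cid => g []. Qed.

Lemma sq_invK : cancel sq_inv (@sq Q).
Proof. by rewrite /sq_inv; case: cid => g []. Qed.

Definition smul (x y : Q) : Q := sq_inv (mul x y).
Definition sldiv (x y : Q) : Q := ldiv x (sq y).

Lemma smulK x : cancel (smul x) (sldiv x).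
Proof. by move=> y; rewrite /sldiv /smul sq_invK mulK. Qed.

Lemma sldivK x : cancel (sldiv x) (smul x).
Proof. by move=> y; rewrite /sldiv /smul ldivK sqK. Qed.

Definition sq_isotope : leftQuasigroup :=
  LeftQuasigroup (nonempty Q) smulK sldivK.

End SquareIsotope.

Inductive term (k : nat) : Type :=
| Var of 'I_k
| Mul of term k & term k
| Ldiv of term k & term k.

Fixpoint eval (Q : leftQuasigroup) (k : nat) (t : term k) (e : k.-tuple Q) : Q :=
  match t with
  | Var i => tnth e i
  | Mul t1 t2 => mul (eval t1 e) (eval t2 e)
  | Ldiv t1 t2 => ldiv (eval t1 e) (eval t2 e)
  end.

Record congruence (Q : leftQuasigroup) := Congruence {
  cong_rel :> Q -> Q -> Prop;
  cong_refl : forall x, cong_rel x x;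
  cong_sym : forall x y, cong_rel x y -> cong_rel y x;
  cong_trans : forall x y z, cong_rel x y -> cong_rel y z -> cong_rel x z;
  cong_mul : forall x x' y y', cong_rel x x' -> cong_rel y y' ->
    cong_rel (mul x y) (mul x' y');
  cong_ldiv : forall x x' y y', cong_rel x x' -> cong_rel y y' ->
    cong_rel (ldiv x y) (ldiv x' y')
}.

Definition cong0 (Q : leftQuasigroup) : congruence Q.
Proof. by exists (@eq Q) => // [x y z -> | x x' y y' -> -> | x x' y y' -> ->]. Defined.

Definition cong1 (Q : leftQuasigroup) : congruence Q.
Proof. by exists (fun _ _ : Q => True). Defined.

Definition cong_le (Q : leftQuasigroup) (alpha beta : congruence Q) : Prop :=
  forall x y, alpha x y -> beta x y.

Definition centralizes (Q : leftQuasigroup)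
    (alpha beta delta : congruence Q) : Prop :=
  forall (k : nat) (t : term k.+1) (a b : Q) (u v : k.-tuple Q),
    alpha a b -> (forall i, beta (tnth u i) (tnth v i)) ->
    delta (eval t [tuple of a :: u]) (eval t [tuple of a :: v]) ->
    delta (eval t [tuple of b :: u]) (eval t [tuple of b :: v]).

Definition central (Q : leftQuasigroup) (alpha : congruence Q) : Prop :=
  centralizes alpha (cong1 Q) (cong0 Q).

Section Quotient.

Variables (Q : leftQuasigroup) (alpha : congruence Q).

(* [{classic Q}] is [Q] with the choice structure of classical logic, which
   the quotient types of [generic_quotient] require. *)
Definition cong_bool (x y : {classic Q}) : bool := `[< alpha x y >].

Lemma cong_bool_equiv : equiv_class_of cong_bool.
Proof.
split=> [x | x y | y x z]; rewrite /cong_bool.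
- exact/asboolP/cong_refl.
- by apply/asboolP/asboolP; exact: cong_sym.
- by move=> /asboolP xy /asboolP yz; apply/asboolP/(cong_trans xy yz).
Qed.

Definition cong_equiv : equiv_rel {classic Q} := EquivRelPack cong_bool_equiv.

Definition quot_carrier : Type := {eq_quot cong_equiv}.

Definition quot_pi (x : Q) : quot_carrier :=
  \pi_({eq_quot cong_equiv}) (x : {classic Q}).

Definition quot_repr (p : quot_carrier) : Q :=
  repr (p : {eq_quot cong_equiv}).

Lemma quot_reprK : cancel quot_repr quot_pi.
Proof. exact: reprK. Qed.

Lemma quot_piE x y : quot_pi x = quot_pi y <-> alpha x y.
Proof.
split=> [/eqmodP/asboolP // | xy].
by apply/eqmodP/asboolP.
Qed.

Lemma quot_repr_pi x : alpha (quot_repr (quot_pi x)) x.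
Proof. by apply/quot_piE; rewrite quot_reprK. Qed.

Definition quot_mul (p q : quot_carrier) : quot_carrier :=
  quot_pi (mul (quot_repr p) (quot_repr q)).

Definition quot_ldiv (p q : quot_carrier) : quot_carrier :=
  quot_pi (ldiv (quot_repr p) (quot_repr q)).

Lemma quot_mul_pi x y : quot_mul (quot_pi x) (quot_pi y) = quot_pi (mul x y).
Proof. by apply/quot_piE/cong_mul; exact: quot_repr_pi. Qed.

Lemma quot_ldiv_pi x y :
  quot_ldiv (quot_pi x) (quot_pi y) = quot_pi (ldiv x y).
Proof. by apply/quot_piE/cong_ldiv; exact: quot_repr_pi. Qed.

Lemma quot_nonempty : inhabited quot_carrier.
Proof. by case: (nonempty Q) => x; exact: (inhabits (quot_pi x)). Qed.

Lemma quot_mulK p : cancel (quot_mul p) (quot_ldiv p).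
Proof.
move=> q; rewrite -[p]quot_reprK -[q]quot_reprK.
by rewrite quot_mul_pi quot_ldiv_pi mulK.
Qed.

Lemma quot_ldivK p : cancel (quot_ldiv p) (quot_mul p).
Proof.
move=> q; rewrite -[p]quot_reprK -[q]quot_reprK.
by rewrite quot_ldiv_pi quot_mul_pi ldivK.
Qed.

Definition quot : leftQuasigroup :=
  LeftQuasigroup quot_nonempty quot_mulK quot_ldivK.

End Quotient.

Section QuotientCongruence.

Variables (Q : leftQuasigroup) (alpha beta : congruence Q).

Definition quot_cong_rel (p q : quot alpha) : Prop :=
  exists x y : Q, [/\ quot_pi alpha x = p, quot_pi alpha y = q & beta x y].

Hypothesis le_ab : cong_le alpha beta.

Lemma quot_cong_relE x y :
  quot_cong_rel (quot_pi alpha x) (quot_pi alpha y) <-> beta x y.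
Proof.
split=> [[x' [y' [/quot_piE/le_ab xx' /quot_piE/le_ab yy' xy']]] | xy].
  exact: cong_trans (cong_trans (cong_sym xx') xy') yy'.
by exists x, y.
Qed.

Definition quot_cong : congruence (quot alpha).
Proof.
exists quot_cong_rel.
- by move=> p; rewrite -[p]quot_reprK; apply/quot_cong_relE/cong_refl.
- by move=> p q [x [y [<- <- xy]]]; apply/quot_cong_relE/cong_sym.
- move=> p q r; rewrite -[p]quot_reprK -[q]quot_reprK -[r]quot_reprK.
  move=> /quot_cong_relE pq /quot_cong_relE qr.
  exact/quot_cong_relE/(cong_trans pq qr).
- move=> _ _ _ _ [x [x' [<- <- xx']]] [y [y' [<- <- yy']]] /=.
  by rewrite !quot_mul_pi; apply/quot_cong_relE/cong_mul.
- move=> _ _ _ _ [x [x' [<- <- xx']]] [y [y' [<- <- yy']]] /=.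
  by rewrite !quot_ldiv_pi; apply/quot_cong_relE/cong_ldiv.
Defined.

End QuotientCongruence.

(* Only [alpha 0, ..., alpha m] matter. *)
Definition has_central_chain (Q : leftQuasigroup) (m : nat) : Prop :=
  exists alpha : nat -> congruence Q,
    [/\ forall x y, alpha 0 x y <-> cong0 Q x y,
        forall x y, alpha m x y <-> cong1 Q x y &
        forall i, i < m ->
          exists le_i : cong_le (alpha i) (alpha i.+1), central (quot_cong le_i)].

Definition nilpotent_of_length (Q : leftQuasigroup) (n : nat) : Prop :=
  has_central_chain Q n /\ forall m, has_central_chain Q m -> n <= m.

(* Main.v *)
(** The squaring map is an automorphism of both quasigroups, and each operation
is the other one followed by a power of it.  A central chain need not consist of
congruences invariant under this automorphism, but replacing each member by
the largest fully invariant congruence below it keeps the chain central; after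
that the members are congruences of both structures.  Centrality transfers
because, for an invariant [delta], the quadruples [(p, q, r, s)] such that
[t(p, u) delta t(q, v)] implies [t(r, u) delta t(s, v)] for all term operations
[t] are closed under the operations and under the automorphism. *)

From mathcomp Require Import all_boot.
Require Import Defs.

Set Implicit Arguments.
Unset Strict Implicit.
Unset Printing Implicit Defensive.

Fixpoint subst (k l : nat) (f : 'I_k -> term l) (t : term k) : term l :=
  match t with
  | Var i => f i
  | Mul t1 t2 => Mul (subst f t1) (subst f t2)
  | Ldiv t1 t2 => Ldiv (subst f t1) (subst f t2)
  end.

Lemma eval_subst (Q : leftQuasigroup) k l (f : 'I_k -> term l) (t : term k)
    (e : l.-tuple Q) (e' : k.-tuple Q) :
  (forall i, eval (f i) e = tnth e' i) -> eval (subst f t) e = eval t e'.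
Proof.
by move=> fE; elim: t => [i|t1 IH1 t2 IH2|t1 IH1 t2 IH2] /=; rewrite ?IH1 ?IH2.
Qed.

Lemma eval_map (Q P : leftQuasigroup) (f : Q -> P) k (t : term k)
    (e : k.-tuple Q) :
  {morph f : x y / mul x y} -> {morph f : x y / ldiv x y} ->
  eval t [tuple of map f e] = f (eval t e).
Proof.
move=> fM fD; elim: t => [i|t1 IH1 t2 IH2|t1 IH1 t2 IH2] /=.
- by rewrite tnth_map.
- by rewrite IH1 IH2 fM.
- by rewrite IH1 IH2 fD.
Qed.

Lemma map_cons_tuple (A B : Type) (f : A -> B) k (a : A) (u : k.-tuple A) :
  [tuple of map f [tuple of a :: u]] = [tuple of f a :: [tuple of map f u]].
Proof. exact: val_inj. Qed.

Lemma morph_ldiv (Q : leftQuasigroup) (f : Q -> Q) :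
  {morph f : x y / mul x y} -> {morph f : x y / ldiv x y}.
Proof. by move=> fM x y; rewrite -{2}(ldivK x y) fM mulK. Qed.

(** Terms commute with the projection and every tuple of the quotient lifts through [quot_repr], so
    chains can be handled in [Q] itself. *)
Lemma central_quotE (Q : leftQuasigroup) (alpha beta : congruence Q)
    (le_ab : cong_le alpha beta) :
  central (quot_cong le_ab) <-> centralizes beta (cong1 Q) alpha.
Proof.
have piE k (t : term k.+1) (a : Q) (u : k.-tuple Q) :
    eval (Q := quot alpha) t
      [tuple of quot_pi alpha a :: [tuple of map (quot_pi alpha) u]]
    = quot_pi alpha (eval t [tuple of a :: u]).
  rewrite -map_cons_tuple.
  apply: (@eval_map Q (quot alpha)) => x y /=.
    by rewrite quot_mul_pi.
  by rewrite quot_ldiv_pi.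
have reprE k (u : k.-tuple (quot alpha)) :
    u = [tuple of map (quot_pi alpha) [tuple of map (@quot_repr Q alpha) u]].
  by apply: eq_from_tnth => i; rewrite !tnth_map quot_reprK.
split=> C k t a b u v ab uv.
- move=> /quot_piE; rewrite -!piE => H; apply/quot_piE; rewrite -!piE.
  by apply: C H => //; apply/quot_cong_relE.
- rewrite -(quot_reprK a) -(quot_reprK b) in ab *.
  move/(quot_cong_relE le_ab): ab => ab.
  rewrite (reprE _ u) (reprE _ v) !piE => /quot_piE H; apply/quot_piE.
  exact: C ab _ H.
Qed.

Lemma has_central_chainE (Q : leftQuasigroup) (m : nat) :
  has_central_chain Q m <->
  exists alpha : nat -> congruence Q,
    [/\ forall x y, alpha 0 x y <-> x = y,
        forall x y, alpha m x y &
        forall i, i < m -> cong_le (alpha i) (alpha i.+1) /\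
          centralizes (alpha i.+1) (cong1 Q) (alpha i)].
Proof.
split=> [[alpha [a0 am aC]]|[alpha [a0 am aC]]]; exists alpha; split=> //.
- by move=> x y; apply/am.
- by move=> i /aC[le_i /central_quotE].
- by move=> i /aC[le_i C]; exists le_i; apply/central_quotE.
Qed.

Section FullyInvariantCore.

Variables (Q : leftQuasigroup) (alpha : congruence Q).

Definition core_rel (x y : Q) : Prop :=
  forall f : Q -> Q, {morph f : x y / mul x y} -> alpha (f x) (f y).

Definition core : congruence Q.
Proof.
exists core_rel.
- by move=> x f _; exact: cong_refl.
- by move=> x y xy f fM; exact/cong_sym/xy.
- by move=> x y z xy yz f fM; exact: cong_trans (xy f fM) (yz f fM).
- move=> x x' y y' xx' yy' f fM; rewrite !fM.
  by apply: cong_mul; [exact: xx'|exact: yy'].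
- move=> x x' y y' xx' yy' f fM; rewrite !(morph_ldiv fM).
  by apply: cong_ldiv; [exact: xx'|exact: yy'].
Defined.

Lemma core_morph (f : Q -> Q) x y :
  {morph f : x y / mul x y} -> core x y -> core (f x) (f y).
Proof. by move=> fM xy g gM; apply: (xy (g \o f)) => u v /=; rewrite fM gM. Qed.

Lemma core_sub : cong_le core alpha.
Proof. by move=> x y /(_ id); apply. Qed.

End FullyInvariantCore.

Lemma core_mono (Q : leftQuasigroup) (alpha beta : congruence Q) :
  cong_le alpha beta -> cong_le (core alpha) (core beta).
Proof. by move=> le_ab x y xy f fM; exact/le_ab/xy. Qed.

(** An endomorphism moves inside terms, and the moved parameters stay admissible because the middle
    congruence is [cong1]. *)
Lemma core_centralizes (Q : leftQuasigroup) (alpha delta : congruence Q) :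
  centralizes alpha (cong1 Q) delta ->
  centralizes (core alpha) (cong1 Q) (core delta).
Proof.
move=> C k t a b u v ab uv H f fM; move: (H f fM).
have fD := morph_ldiv fM.
by rewrite -!eval_map // !map_cons_tuple; apply: C => //; exact: ab.
Qed.

Section Preserves.

Variables (Q : leftQuasigroup) (delta : congruence Q).

(** Four separate entries, since the values of a composite term at (a, u), (a, v), (b, u), (b, v)
    differ in general. *)
Definition preserves (p q r s : Q) : Prop :=
  forall (k : nat) (t : term k.+1) (u v : k.-tuple Q),
    delta (eval t [tuple of p :: u]) (eval t [tuple of q :: v]) ->
    delta (eval t [tuple of r :: u]) (eval t [tuple of s :: v]).

Lemma preserves_delta p q r s : preserves p q r s -> delta p q -> delta r s.
Proof. by move=> /(_ 0 (Var ord0) [tuple] [tuple]). Qed.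

(* The arguments of the binary operation are exchanged one after the other,
   the other argument being a parameter. *)
Lemma preserves_op (op : Q -> Q -> Q)
    (T : forall k, term k -> term k -> term k) :
  (forall k (t1 t2 : term k) e,
    eval (T k t1 t2) e = op (eval t1 e) (eval t2 e)) ->
  forall p q r s p' q' r' s', preserves p q r s -> preserves p' q' r' s' ->
  preserves (op p p') (op q q') (op r r') (op s s').
Proof.
move=> TE p q r s p' q' r' s' pqrs pqrs' k t u v.
(* This expands the leading variable into [T] of two variables; exchanging [i0] and [i1] puts either
   argument in the leading place, where [preserves] acts. *)
pose f (i0 i1 : 'I_k.+2) (i : 'I_k.+1) : term k.+2 :=
  oapp (fun j => Var (lift ord0 (lift ord0 j))) (T _ (Var i0) (Var i1))
    (unlift ord0 i).
have f01 x y (w : k.-tuple Q) :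
    eval t [tuple of op x y :: w]
    = eval (subst (f ord0 (lift ord0 ord0)) t)
        [tuple of x :: [tuple of y :: w]].
  apply/esym/eval_subst => i; rewrite /f.
  by case: unliftP => [j|] -> /=; rewrite ?TE /= ?tnthS ?tnth0.
have f10 x y (w : k.-tuple Q) :
    eval t [tuple of op x y :: w]
    = eval (subst (f (lift ord0 ord0) ord0) t)
        [tuple of y :: [tuple of x :: w]].
  apply/esym/eval_subst => i; rewrite /f.
  by case: unliftP => [j|] -> /=; rewrite ?TE /= ?tnthS ?tnth0.
by rewrite !f01 => /pqrs; rewrite -!f01 !f10 => /pqrs'.
Qed.

(** Since t(f x, w) = f(t(x, g w)), invariance under [g] strips the outer [f] and invariance under
    [f] restores it. *)
Lemma preserves_aut (f g : Q -> Q) :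
  {morph f : x y / mul x y} -> cancel f g -> cancel g f ->
  (forall x y, delta x y -> delta (f x) (f y)) ->
  (forall x y, delta x y -> delta (g x) (g y)) ->
  forall p q r s, preserves p q r s -> preserves (f p) (f q) (f r) (f s).
Proof.
move=> fM fK gK fdelta gdelta p q r s pqrs k t u v.
have fE x (w : k.-tuple Q) :
    eval t [tuple of f x :: w] = f (eval t [tuple of x :: [tuple of map g w]]).
  rewrite -eval_map //; last exact: morph_ldiv.
  by congr eval; apply: val_inj; rewrite /= mapK.
by rewrite !fE => /gdelta; rewrite !fK => /pqrs /fdelta.
Qed.

End Preserves.

Section Twist.

Variables (Q : leftQuasigroup) (f g : Q -> Q).
Hypotheses (fM : {morph f : x y / mul x y}) (fK : cancel f g) (gK : cancel g f).
Variables (mulP ldivP : Q -> Q -> Q) (neP : inhabited Q).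
Hypotheses (mulPK : forall x, cancel (mulP x) (ldivP x))
  (ldivPK : forall x, cancel (ldivP x) (mulP x)).
Hypothesis mulPE : forall x y, mulP x y = f (mul x y).

Let P : leftQuasigroup := LeftQuasigroup neP mulPK ldivPK.

Let gM : {morph g : x y / mul x y}.
Proof. by move=> x y; apply: (can_inj fK); rewrite fM !gK. Qed.

Let ldivPE x y : ldivP x y = ldiv x (g y).
Proof. by rewrite -{2}(ldivPK x y) mulPE fK mulK. Qed.

Definition twist_core (alpha : congruence Q) : congruence P.
Proof.
exists (core alpha : P -> P -> Prop).
- exact: (@cong_refl _ (core alpha)).
- exact: (@cong_sym _ (core alpha)).
- exact: (@cong_trans _ (core alpha)).
- move=> x x' y y' xx' yy' /=; rewrite !mulPE.
  by apply: core_morph => //; apply: (@cong_mul _ (core alpha)).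
- move=> x x' y y' xx' yy' /=; rewrite !ldivPE.
  by apply: (@cong_ldiv _ (core alpha)) => //; apply: core_morph.
Defined.

(** By induction on the term of [P], its four values form a quadruple in [preserves] for the terms
    of [Q]. *)
Lemma twist_centralizes (alpha delta : congruence Q) :
  centralizes alpha (cong1 Q) delta ->
  centralizes (twist_core alpha) (cong1 P) (twist_core delta).
Proof.
move=> /core_centralizes C k t a b u v ab _.
apply: (@preserves_delta Q (core delta)).
have coreM h : {morph h : x y / mul x y} ->
  forall x y, core delta x y -> core delta (h x) (h y).
  by move=> hM x y; exact: core_morph.
elim: t => [i|t1 IH1 t2 IH2|t1 IH1 t2 IH2] /=.
(* A parameter gives a trivial quadruple; the leading variable gives (a, a, b, b), which is the
   hypothesis passed to cores. *)
- case: (unliftP ord0 i) => [j|] -> /=; rewrite ?tnthS ?tnth0 // => l t w w'.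
  exact: C.
- rewrite !mulPE; apply: (preserves_aut (g := g)) => //; try exact: coreM.
  exact: (preserves_op (T := @Mul)).
(* Here the automorphism is [g], applied to the second argument before dividing. *)
- rewrite !ldivPE; apply: (preserves_op (T := @Ldiv)) => //.
  by apply: (preserves_aut (g := f)) => //; exact: coreM.
Qed.

(** Equality and the total relation are their own cores, so the length is kept. *)
Lemma twist_central_chain m : has_central_chain Q m -> has_central_chain P m.
Proof.
move=> /has_central_chainE[alpha [a0 am aC]]; apply/has_central_chainE.
exists (fun i => twist_core (alpha i)); split.
- move=> x y; split=> [/core_sub/a0 //|->]; exact: cong_refl.
- by move=> x y h hM; exact: am.
- move=> i /aC[le_i C]; split; last exact: twist_centralizes.
  exact: (core_mono le_i).
Qed.

End Twist.

Lemma sq_morph (Q : leftQuasigroup) :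
  semimedial Q -> {morph (@sq Q) : x y / mul x y}.
Proof. by move=> hsm x y; rewrite /sq hsm. Qed.

Lemma sq_inv_morph (Q : leftQuasigroup) (div2 : two_divisible Q) :
  semimedial Q -> {morph sq_inv div2 : x y / mul x y}.
Proof.
by move=> hsm x y; apply: (can_inj (sqK div2)); rewrite sq_morph // !sq_invK.
Qed.

(** The squaring is that of [Q]; the isotope's own squaring is the identity. *)
Lemma sq_morph_isotope (Q : leftQuasigroup) (div2 : two_divisible Q) :
  semimedial Q ->
  {morph (@sq Q : sq_isotope div2 -> sq_isotope div2) : x y / mul x y}.
Proof. by move=> hsm x y; rewrite /= /smul -sq_morph // sqK sq_invK. Qed.

(** Each structure is a twist of the other: the isotope by [sq_inv], and [Q] by [sq]. *)
Lemma sq_isotope_chain (Q : leftQuasigroup) (hsm : semimedial Q)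
    (div2 : two_divisible Q) m :
  has_central_chain Q m <-> has_central_chain (sq_isotope div2) m.
Proof.
split.
  apply: (twist_central_chain _ (sq_invK div2) (sqK div2)) => //.
  exact: sq_inv_morph.
have sM := sq_morph_isotope (div2 := div2) hsm.
have sK := sqK div2; have gK := sq_invK div2.
(* Only for an explicit [LeftQuasigroup] is [Q] convertible to a twist. *)
case: Q hsm div2 sM sK gK => T mulQ ldivQ neQ mulQK ldivQK hsm div2 sM sK gK.
by apply: (twist_central_chain sM sK gK) => x y; exact/esym/gK.
Qed.

Theorem proposition3p18 (Q : leftQuasigroup) (hsm : semimedial Q)
    (div2 : two_divisible Q) (n : nat) :
  nilpotent_of_length Q n <-> nilpotent_of_length (sq_isotope div2) n.
Proof.
by split=> -[nC nmin]; split=> [|m mC]; try apply: nmin;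
  exact/(sq_isotope_chain hsm div2).
Qed.
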